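(* In the synchronous single-port message-passing model with crash failures, for every $n$ and every $t$ with $0<t<n$, any deterministic algorithm solving fault-tolerant consensus, gossiping, or checkpointing with up to $t$ crashes requires $\Omega(t+\log n)$ rounds in the worst case (over inputs and crash patterns with at most $t$ crashes).
   Context: Model: $n$ nodes with distinct names in $\{1,\dots,n\}$; $n$ and $t$ are known. Synchronous rounds; single-port: in each round a node may send a message to at most one other node and receive a message from at most one other node. An adversary crashes up to $t$ nodes at times of its choosing; a crashed node performs no further activity. Binary consensus: each node has input bit, non-crashed nodes decide and halt, all decisions equal, each decision is some node's input. Gossiping: each node has a rumor; each non-crashed node halts with an extant set of (name, rumor) pairs that excludes pairs of nodes that crashed before sending any message and includes pairs of all nodes that halted without crashing. Checkpointing: each non-crashed node halts with an extant set of names that excludes nodes that crashed before sending any message, includes all nodes that halted without crashing, and all decided sets are equal. Running time: number of rounds until all non-faulty nodes halt. *)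

(* Defs.v *)
From HB Require Import structures.
From mathcomp Require Import all_boot all_order all_algebra.
From mathcomp Require Import finmap.
From mathcomp Require Import reals exp.

Set Implicit Arguments.
Unset Strict Implicit.
Unset Printing Implicit Defensive.

(* A deterministic algorithm for n nodes named by 'I_n; the number of nodes
   and the bound on crashes are fixed when the algorithm is chosen, hence
   known to it.  In each round a node chooses, from its local state alone, at
   most one node to send a message to and at most one node to receive from;
   the outcome of the reception determines whether it continues (inl) or halts
   with an output (inr). *)
Record algorithm (n : nat) (X Y : Type) := Algorithm {
  state : Type;
  message : Type;
  start : 'I_n -> X -> state;
  send : state -> option ('I_n * message);
  poll : state -> option 'I_n;
  next : state -> option message -> state + Y
}.

(* What happens to a message whose addressee does not receive from its sender
   in the round of sending: it is lost, or it waits in a first-in first-out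
   buffer of the port until it is received. *)
Variant port_mode := Unbuffered | Buffered.

Variant status (S Y : Type) := Running of S | Halted of Y | Crashed.
Arguments Running {S Y}.
Arguments Halted {S Y}.
Arguments Crashed {S Y}.

(* F v = Some (r, b): node v crashes in round r (rounds are numbered from 0),
   after sending its message of that round if b, before sending it otherwise.
   A crash scheduled after v has halted has no effect. *)
Definition crash_pattern (n : nat) := 'I_n -> option (nat * bool).

Definition num_crashes (n : nat) (F : crash_pattern n) : nat :=
  #|[set v | isSome (F v)]|.

(* pending c v u: messages from u waiting at v, oldest first. *)
Record config n X Y (A : algorithm n X Y) := Config {
  node : 'I_n -> status (state A) Y;
  pending : 'I_n -> 'I_n -> seq (message A)
}.

Definition initial n X Y (A : algorithm n X Y) (x : 'I_n -> X) : config A :=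
  Config (fun v => Running (start A v (x v))) (fun _ _ => [::]).

(* Messages addressed to oneself are not transmitted. *)
Definition outgoing n X Y (A : algorithm n X Y) (F : crash_pattern n)
    (r : nat) (c : config A) (u : 'I_n) : option ('I_n * message A) :=
  if node c u is Running s then
    if F u == Some (r, false) then None
    else if send s is Some (w, m) then
      if w == u then None else Some (w, m)
    else None
  else None.

Definition available n X Y (A : algorithm n X Y) (F : crash_pattern n)
    (r : nat) (c : config A) (v u : 'I_n) : seq (message A) :=
  pending c v u ++
  (if outgoing F r c u is Some (w, m) then
     if w == v then [:: m] else [::]
   else [::]).

Definition crashes_in_round n (F : crash_pattern n) (r : nat) (v : 'I_n) :
    bool :=
  if F v is Some (r', _) then r' == r else false.

Definition receives_from n X Y (A : algorithm n X Y) (F : crash_pattern n)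
    (r : nat) (c : config A) (v : 'I_n) : option 'I_n :=
  if node c v is Running s then
    if crashes_in_round F r v then None else poll s
  else None.

Definition received n X Y (A : algorithm n X Y) (F : crash_pattern n)
    (r : nat) (c : config A) (v : 'I_n) : option (message A) :=
  if receives_from F r c v is Some u then ohead (available F r c v u)
  else None.

Definition round n X Y (mode : port_mode) (A : algorithm n X Y)
    (F : crash_pattern n) (r : nat) (c : config A) : config A :=
  Config
    (fun v =>
       if node c v is Running s then
         if crashes_in_round F r v then Crashed
         else match next s (received F r c v) with
              | inl s' => Running s'
              | inr y => Halted y
              end
       else node c v)
    (fun v u =>
       if mode is Unbuffered then [::]
       else if receives_from F r c v == Some u
            then behead (available F r c v u)
            else available F r c v u).

(* The configuration after r rounds. *)
Fixpoint execution n X Y (mode : port_mode) (A : algorithm n X Y)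
    (x : 'I_n -> X) (F : crash_pattern n) (r : nat) : config A :=
  if r is r'.+1 then round mode F r' (execution mode A x F r')
  else initial A x.

Definition halts_with n X Y (A : algorithm n X Y) (e : nat -> config A)
    (v : 'I_n) (y : Y) : Prop :=
  exists r, node (e r) v = Halted y.

Definition crashes n X Y (A : algorithm n X Y) (e : nat -> config A)
    (v : 'I_n) : Prop :=
  exists r, node (e r) v = Crashed.

Definition crashes_silently n X Y (A : algorithm n X Y) (F : crash_pattern n)
    (e : nat -> config A) (v : 'I_n) : Prop :=
  crashes e v /\ forall r, outgoing F r (e r) v = None.

Definition terminates n X Y (A : algorithm n X Y) (e : nat -> config A) :
    Prop :=
  forall v, ~ crashes e v -> exists y, halts_with e v y.

Definition solves_consensus (mode : port_mode) n (t : nat)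
    (A : algorithm n bool bool) : Prop :=
  forall (x : 'I_n -> bool) (F : crash_pattern n), num_crashes F <= t ->
  let e := execution mode A x F in
  [/\ terminates e,
      forall v w y z, halts_with e v y -> halts_with e w z -> y = z
    & forall v y, halts_with e v y -> exists w, y = x w].

Definition solves_gossiping (mode : port_mode) n (t : nat)
    (Rumor : choiceType) (A : algorithm n Rumor {fset 'I_n * Rumor}) : Prop :=
  forall (x : 'I_n -> Rumor) (F : crash_pattern n), num_crashes F <= t ->
  let e := execution mode A x F in
  [/\ terminates e,
      forall v E w, halts_with e v E ->
        crashes_silently F e w -> (w, x w) \notin E
    & forall v E w E', halts_with e v E ->
        halts_with e w E' -> (w, x w) \in E].

Definition solves_checkpointing (mode : port_mode) n (t : nat)
    (A : algorithm n unit {set 'I_n}) : Prop :=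
  forall (x : 'I_n -> unit) (F : crash_pattern n), num_crashes F <= t ->
  let e := execution mode A x F in
  [/\ terminates e,
      forall v E w, halts_with e v E ->
        crashes_silently F e w -> w \notin E,
      forall v E w E', halts_with e v E ->
        halts_with e w E' -> w \in E
    & forall v E w E', halts_with e v E -> halts_with e w E' -> E = E'].

Definition finished_by n X Y (A : algorithm n X Y) (e : nat -> config A)
    (T : nat) : Prop :=
  forall v, ~ crashes e v -> exists y, node (e T) v = Halted y.

Definition running_time n X Y (A : algorithm n X Y) (e : nat -> config A)
    (T : nat) : Prop :=
  finished_by e T /\ forall T', finished_by e T' -> T <= T'.

(* Some execution with at most t crashes takes at least b rounds. *)
Definition worst_case_at_least (R : realType) (mode : port_mode) n (t : nat)
    X Y (A : algorithm n X Y) (b : R) : Prop :=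
  exists (x : 'I_n -> X) (F : crash_pattern n) (T : nat),
    [/\ num_crashes F <= t,
        running_time (execution mode A x F) T
      & (b <= T%:R)%R].

(* Main.v *)
Require Import Defs.
From HB Require Import structures.
From mathcomp Require Import all_boot all_order all_algebra.
From mathcomp Require Import finmap.
From mathcomp Require Import reals exp.
From mathcomp Require Import boolp zify lra.

(** Suppose that every execution with at most [t] crashes ends within [k]
    rounds.

    [n <= 3 ^ k]: let two executions differ at first in a single node only.
    In each round a node whose behaviour differs can spoil at most two further
    nodes, its addressees in the two executions, so at most [3 ^ k] nodes
    differ after [k] rounds.  But all outputs differ, for gossiping and
    checkpointing when the node crashes at once or not at all, for consensus
    when its input is pivotal on the way from all inputs 0 to all inputs 1.

    [t <= 2 * k]: a node that never receives anything polls at most [k] others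
    in [k] rounds; if exactly these crash at the start, it indeed receives
    nothing and halts in ignorance.  It then cannot know whether one further
    node has crashed, which settles gossiping and checkpointing.  For consensus,
    two nodes with different inputs are isolated in this way at the same time,
    after choosing them such that neither polls the other. *)

Set Implicit Arguments.
Unset Strict Implicit.
Unset Printing Implicit Defensive.

(** * Two combinatorial lemmas *)

Lemma prop_switch (P : nat -> Prop) (n : nat) :
  ~ P 0 -> P n -> exists2 i, i < n & ~ P i /\ P i.+1.
Proof.
move=> P0; elim: n => [|n IHn] Pn; first by case: P0.
have [Pn'|nPn] := pselect (P n); last by exists n.
by have [i ltin Pi] := IHn Pn'; exists i => //; apply: ltnW.
Qed.

(** Double counting. If no such pair existed, every [v] together with [U v] and the set [V v] of
    those [w] with [v \in W w] would cover all nodes. The sizes of the [V v] add up to those of the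
    [W w], so summing over [v] gives [n * n <= n * (k + k + 1)]. *)
Lemma exists_mutual_nonmembers (n k : nat) (U W : 'I_n -> {set 'I_n}) :
  (forall v, #|U v| <= k) -> (forall v, #|W v| <= k) -> k.*2.+1 < n ->
  exists v w, [/\ v != w, w \notin U v & v \notin W w].
Proof.
move=> leU leW ltkn; apply: contrapT => none.
pose V v := [set w | v \in W w].
have cover v : n <= #|U v| + #|V v| + 1.
  have full : #|U v :|: V v :|: [set v]| = n.
    rewrite -[RHS]card_ord -cardsT; apply: eq_card => w; rewrite !inE.
    apply/negPn; rewrite !negb_or; apply/negP => /andP[/andP[wU vW] wv].
    by apply: none; exists v, w; rewrite eq_sym.
  rewrite -{1}full -(cards1 v); apply: leq_trans (leq_card_setU _ _) _.
  by rewrite leq_add2r leq_card_setU.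
have sumV : \sum_v #|V v| = \sum_w #|W w|.
  transitivity (\sum_v \sum_w (v \in W w : nat)).
    apply: eq_bigr => v _; rewrite -sum1dep_card big_mkcond /=.
    by apply: eq_bigr => w _; case: (v \in W w).
  rewrite exchange_big /=; apply: eq_bigr => w _.
  by rewrite -sum1_card [RHS]big_mkcond; apply: eq_bigr => v _; case: ifP.
have: \sum_(v < n) n <= \sum_(v < n) (#|U v| + #|V v| + 1).
  by apply: leq_sum => v _.
have: \sum_v #|U v| <= \sum_(v < n) k by apply: leq_sum => v _.
have: \sum_v #|W v| <= \sum_(v < n) k by apply: leq_sum => v _.
rewrite !big_split /= sumV !sum_nat_const card_ord => hW hU hS.
have {hS hU hW} := leq_trans hS (leq_add (leq_add hU hW) (leqnn _)).
by rewrite -!mulnDr leq_pmul2l; lia.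
Qed.

(** * Halting and running time *)

Section Executions.
Variables (n : nat) (X Y : Type) (mode : port_mode) (A : algorithm n X Y).

Lemma halted_persists (x : 'I_n -> X) (F : crash_pattern n) r r' v y :
  r <= r' -> node (execution mode A x F r) v = Halted y ->
  node (execution mode A x F r') v = Halted y.
Proof.
move=> /subnK <- hr; elim: (r' - r) => [//|d IHd].
by rewrite addSn /= IHd.
Qed.

Lemma no_crash (x : 'I_n -> X) (F : crash_pattern n) v :
  F v = None -> ~ crashes (execution mode A x F) v.
Proof.
move=> Fv [r]; elim: r => //= r IHr.
by case: (node _ v) IHr => //= s _; rewrite /crashes_in_round Fv; case: (Defs.next _ _).
Qed.

Lemma terminates_finished (x : 'I_n -> X) (F : crash_pattern n) :
  let e := execution mode A x F in
  terminates e -> exists T, finished_by e T.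
Proof.
move=> e term.
have /choice[T TP] v : exists r, ~ crashes e v -> exists y, node (e r) v = Halted y.
  have [cv|/term[y [r hr]]] := pselect (crashes e v); first by exists 0 => /(_ cv).
  by exists r => _; exists y.
exists (\max_v T v) => v /TP[y hy]; exists y.
by apply: halted_persists hy; apply: leq_bigmax.
Qed.

(** Termination yields a least [T] by which the unfinished execution is finished. Halted nodes stay
    halted, so [T <= k] would make it finished by [k] as well. *)
Lemma worst_case_of_unfinished (R : realType) (t k : nat) (b : R) :
  (forall x F, num_crashes F <= t -> terminates (execution mode A x F)) ->
  (b <= k.+1%:R)%R ->
  ~ (forall x F, num_crashes F <= t -> finished_by (execution mode A x F) k) ->
  worst_case_at_least mode t A b.
Proof.
move=> term leb /existsNP[x /existsNP[F /not_implyP[leF nfin]]].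
have exT : exists T, `[< finished_by (execution mode A x F) T >].
  by have [T /asboolP fT] := terminates_finished (term x F leF); exists T.
case: (ex_minnP exT) => T /asboolP finT minT.
exists x, F, T; split=> //.
  by split=> // T' /asboolP /minT.
apply: (Order.POrderTheory.le_trans leb); rewrite Num.Theory.ler_nat.
rewrite ltnNge; apply/negP => leTk; apply: nfin => v /finT[y hy].
by exists y; apply: halted_persists hy.
Qed.

(** * Spread of a difference in one node *)

Definition addressee (F : crash_pattern n) r (c : config A) (u : 'I_n) :
    option 'I_n := omap fst (outgoing F r c u).

Lemma available_unaddressed (F : crash_pattern n) r (c : config A) v u :
  addressee F r c u != Some v -> available F r c v u = pending c v u.
Proof.
rewrite /addressee /available; case: outgoing => [[w m]|] /=; last by rewrite cats0.
by have [->|_] := eqVneq w v; rewrite ?eqxx ?cats0.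
Qed.

(* Buffers do no harm, since the invariant includes that the ports of unspoiled
   nodes hold the same messages in both executions. *)
Lemma difference_spread (x x' : 'I_n -> X) (F F' : crash_pattern n) p r :
  (forall v, v != p -> x v = x' v) -> (forall v, v != p -> F v = F' v) ->
  exists2 B : {set 'I_n}, #|B| <= 3 ^ r &
    forall v, v \notin B ->
      node (execution mode A x F r) v = node (execution mode A x' F' r) v.
Proof.
move=> xx' FF'.
set e := execution mode A x F; set e' := execution mode A x' F'.
suff [B [pB cB nB _]] : exists B : {set 'I_n}, [/\ p \in B, #|B| <= 3 ^ r,
    forall v, v \notin B -> node (e r) v = node (e' r) v &
    forall v u, v \notin B -> pending (e r) v u = pending (e' r) v u].
  by exists B.
elim: r => [|r [B [pB cB nB qB]]].
  exists [set p]; split=> //=; rewrite ?set11 ?cards1 // => v.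
  by rewrite inE => /xx' ->.
(* The addressees under [f] of senders in [B]. Each sender has at most one, so there are at most
   [#|B|] of them, and adding those of both executions at most triples [B]. *)
pose spoiled (f : 'I_n -> option 'I_n) : {set 'I_n} := [set v | [exists u in B, f u == Some v]].
have spoiled_card f : #|spoiled f| <= #|B|.
  have -> : #|spoiled f| = #|Some @: spoiled f|.
    by rewrite card_imset //; apply: Some_inj.
  apply: leq_trans (leq_imset_card f (mem B)).
  apply: subset_leq_card; apply/subsetP => o /imsetP[v + ->].
  by rewrite inE => /existsP[u /andP[uB /eqP fu]]; rewrite -fu; apply: imset_f.
pose a := addressee F r (e r); pose a' := addressee F' r (e' r).
pose B' := B :|: spoiled a :|: spoiled a'.
have notB v : v \notin B' -> v \notin B.
  by rewrite !inE !negb_or => /andP[/andP[]].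
have neqp v : v \notin B -> v != p by apply: contraNneq => ->.
have avail v u : v \notin B' -> available F r (e r) v u = available F' r (e' r) v u.
  move=> vB'; have vB := notB v vB'.
  (* A sender in [B] addresses [v] in neither execution, as [v] is not spoiled, so only the equal
     buffers count. A sender outside [B] acts alike in both. *)
  have [uB|uB] := boolP (u \in B).
    rewrite !available_unaddressed ?qB //; apply: contraNN vB' => uv;
      rewrite !inE; apply/orP; [right | left; apply/orP; right];
      by apply/existsP; exists u; rewrite uB.
  by rewrite /available /outgoing nB // qB // FF' ?neqp.
have polls v : v \notin B' -> receives_from F r (e r) v = receives_from F' r (e' r) v.
  by move=> /notB vB; rewrite /receives_from /crashes_in_round nB // FF' ?neqp.
exists B'; split.
- by rewrite !inE pB.
- rewrite expnS; have := spoiled_card a; have := spoiled_card a'.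
  have := (leq_card_setU (B :|: spoiled a) (spoiled a')).1.
  by have := (leq_card_setU B (spoiled a)).1; rewrite -/B'; lia.
- move=> v vB'; rewrite /= -/(e r) -/(e' r) nB ?notB //.
  have -> : received F r (e r) v = received F' r (e' r) v.
    by rewrite /received polls //; case: receives_from => // u; rewrite avail.
  by rewrite /crashes_in_round FF' // neqp ?notB.
- by move=> v u vB'; rewrite /= -/(e r) -/(e' r) polls // avail.
Qed.

Lemma all_differ_bound (x x' : 'I_n -> X) (F F' : crash_pattern n) p r :
  (forall v, v != p -> x v = x' v) -> (forall v, v != p -> F v = F' v) ->
  (forall v, node (execution mode A x F r) v <> node (execution mode A x' F' r) v) ->
  n <= 3 ^ r.
Proof.
move=> xx' FF' neq; have [B cB eqB] := difference_spread r xx' FF'.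
apply: leq_trans cB; rewrite -[X in X <= _]card_ord -cardsT.
apply: subset_leq_card; apply/subsetP => v _.
by apply: contraT => /eqB /neq.
Qed.

(** * Initial crashes and isolated nodes *)

Definition initial_crashes (D : {set 'I_n}) : crash_pattern n :=
  fun v => if v \in D then Some (0, false) else None.

Lemma num_initial_crashes (D : {set 'I_n}) :
  num_crashes (initial_crashes D) = #|D|.
Proof.
by apply: eq_card => v; rewrite inE /initial_crashes; case: (v \in D).
Qed.

Lemma initial_crashes_silent (x : 'I_n -> X) (D : {set 'I_n}) v :
  let e := execution mode A x (initial_crashes D) in
  v \in D -> crashes_silently (initial_crashes D) e v.
Proof.
move=> e vD.
have crashed r : node (e r.+1) v = Crashed.
  elim: r => [|r IHr]; last by move: IHr; rewrite /e /= => ->.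
  by rewrite /= /crashes_in_round /initial_crashes vD.
split; first by exists 1.
case=> [|r]; rewrite /outgoing; last by rewrite crashed.
by rewrite /= /initial_crashes vD eqxx.
Qed.

(* The course of [v] when all its polls come up empty. *)
Fixpoint isolated_status (v : 'I_n) (a : X) (r : nat) : status (state A) Y :=
  if r is r'.+1 then
    if isolated_status v a r' is Running s then
      match Defs.next s None with inl s' => Running s' | inr y => Halted y end
    else isolated_status v a r'
  else Running (start A v a).

Definition isolated_poll (v : 'I_n) (a : X) (r : nat) : option 'I_n :=
  if isolated_status v a r is Running s then poll s else None.

(** [v] itself is left out, since it has to survive; polling itself brings it nothing anyway,
    because messages to oneself are not transmitted. *)
Definition isolators (v : 'I_n) (a : X) (k : nat) : {set 'I_n} :=
  [set u in pmap (isolated_poll v a) (iota 0 k)] :\ v.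

Lemma card_isolators v a k : #|isolators v a k| <= k.
Proof.
apply: leq_trans (subset_leq_card (subsetDl _ _)) _.
rewrite cardsE; apply: leq_trans (card_size _) _.
by rewrite size_pmap; apply: leq_trans (count_size _ _) _; rewrite size_iota.
Qed.

(** In the first [k] rounds [v] polls only itself or nodes of [D]. None of these ever sends to [v],
    so in either port mode their ports at [v] stay empty. *)
Lemma isolated_execution (x : 'I_n -> X) (D : {set 'I_n}) v k :
  v \notin D -> isolators v (x v) k \subset D ->
  node (execution mode A x (initial_crashes D) k) v = isolated_status v (x v) k.
Proof.
move=> vD /subsetP UD; set F := initial_crashes D; set e := execution mode A x F.
have Fv : F v = None by rewrite /F /initial_crashes (negPf vD).
have unaddressed r u : u \in v |: D -> addressee F r (e r) u != Some v.
  rewrite in_setU1 => /orP[/eqP->|uD]; last first.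
    by have [_ silent] := initial_crashes_silent x uD; rewrite /addressee silent.
  rewrite /addressee /outgoing; case: node => // s; case: ifP => // _.
  by case: send => // -[w m]; have [//|wv] := eqVneq w v; rewrite /= (inj_eq (@Some_inj _)).
have empty r u : u \in v |: D -> available F r (e r) v u = [::].
  move=> uD; rewrite available_unaddressed ?unaddressed //.
  elim: r => [//|r IHr]; rewrite /= -/(e r) available_unaddressed ?unaddressed //.
  by rewrite IHr; case: mode => //; case: ifP.
suff: forall r, r <= k -> node (e r) v = isolated_status v (x v) r by apply.
elim=> [//|r IHr ltrk]; have IH := IHr (ltnW ltrk).
have -> : isolated_status v (x v) r.+1 =
  if isolated_status v (x v) r is Running s then
      match Defs.next s None with inl s' => Running s' | inr y => Halted y end
    else isolated_status v (x v) r by [].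
rewrite /= -/(e r) IH.
have -> : received F r (e r) v = None.
  rewrite /received; case def_u: receives_from => [u|//].
  rewrite empty //; move: def_u; rewrite /receives_from IH /crashes_in_round Fv.
  (* By induction the poll of round [r < k] is the isolated one, so its target is [v] or an
     isolator. *)
  move=> def_u; rewrite in_setU1; case: (altP eqP) => //= uv; apply: UD.
  rewrite !inE uv mem_pmap; apply/mapP; exists r; first by rewrite mem_iota.
  by rewrite /isolated_poll def_u.
by rewrite /crashes_in_round Fv.
Qed.

(** * Bounds for gossiping and checkpointing *)

Section Finished.
Variables (t k : nat).
Hypothesis fin : forall (x : 'I_n -> X) (F : crash_pattern n),
  num_crashes F <= t -> finished_by (execution mode A x F) k.

Lemma finished_halted (x : 'I_n -> X) (D : {set 'I_n}) v :
  #|D| <= t -> v \notin D ->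
  exists y, node (execution mode A x (initial_crashes D) k) v = Halted y.
Proof.
move=> leD vD; apply: fin; first by rewrite num_initial_crashes.
by apply: no_crash; rewrite /initial_crashes (negPf vD).
Qed.

Section Extant.
Variables (x : 'I_n -> X) (extant : Y -> 'I_n -> bool).
Hypothesis tn : t < n.
Hypothesis extant_sound : forall F, num_crashes F <= t ->
  let e := execution mode A x F in
  forall v y w, halts_with e v y -> crashes_silently F e w -> ~~ extant y w.
Hypothesis extant_complete : forall F, num_crashes F <= t ->
  let e := execution mode A x F in
  forall v y w z, halts_with e v y -> halts_with e w z -> extant y w.

(** Read [extant y w] as: the output [y] lists [w]. Whether [U] or [w |: U] crashes, [v] is isolated
    and halts with the same output, yet this must list [w] in the first case and omit it in the
    second. *)
Lemma extant_crash_bound : t <= k.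
Proof.
rewrite leqNgt; apply/negP => ltkt.
pose v := Ordinal (leq_ltn_trans (leq0n t) tn).
pose U := isolators v (x v) k; have leU : #|U| <= k by apply: card_isolators.
have vU : v \notin U by rewrite !inE eqxx.
(* [v |: U] has at most [k.+1 <= t < n] elements. *)
have [w wvU] : exists w, w \notin v |: U.
  apply/existsP; rewrite -negb_forall; apply/negP => /forallP all.
  have eqn : #|v |: U| = n by rewrite -[RHS]card_ord; apply: eq_card => w; rewrite all.
  have: #|v |: U| <= k.+1 by rewrite cardsU1 vU.
  by rewrite eqn leqNgt (leq_ltn_trans ltkt tn).
have [wv wU] : w != v /\ w \notin U.
  by move: wvU; rewrite in_setU1 negb_or => /andP.
have leUt : #|U| <= t by apply: leq_trans leU (ltnW ltkt).
have leUwt : #|w |: U| <= t by rewrite cardsU1 wU; apply: leq_ltn_trans leU ltkt.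
have vUw : v \notin w |: U by rewrite in_setU1 negb_or eq_sym wv.
have [y hy] := finished_halted x leUt vU.
have [z hz] := finished_halted x leUt wU.
have hy' : node (execution mode A x (initial_crashes (w |: U)) k) v = Halted y.
  by rewrite -hy !isolated_execution // subsetUr.
have: extant y w.
  apply: (@extant_complete (initial_crashes U)) (ex_intro _ k hy) (ex_intro _ k hz).
  by rewrite num_initial_crashes.
apply/negP; apply: (@extant_sound (initial_crashes (w |: U))) (ex_intro _ k hy') _.
  by rewrite num_initial_crashes.
by apply: initial_crashes_silent; rewrite setU11.
Qed.

(** No crash is compared with the immediate crash of [p]. A status shared by both executions would
    be an output that both lists and omits [p]; this also covers [p] itself. *)
Lemma extant_spread_bound : 0 < t -> n <= 3 ^ k.
Proof.
move=> t0; pose p := Ordinal (leq_ltn_trans (leq0n t) tn).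
have le0 : #|set0 : {set 'I_n}| <= t by rewrite cards0.
have le1 : #|[set p]| <= t by rewrite cards1.
apply: (@all_differ_bound x x (initial_crashes set0) (initial_crashes [set p]) p) => //.
  by move=> v /negPf vp; rewrite /initial_crashes !inE vp.
have [z hz] := finished_halted x le0 (negbT (in_set0 p)).
move=> v; have [y hy] := finished_halted x le0 (negbT (in_set0 v)).
rewrite hy => /esym hy'.
have: extant y p.
  apply: (@extant_complete (initial_crashes set0)) (ex_intro _ k hy) (ex_intro _ k hz).
  by rewrite num_initial_crashes.
apply/negP; apply: (@extant_sound (initial_crashes [set p])) (ex_intro _ k hy') _.
  by rewrite num_initial_crashes.
by apply: initial_crashes_silent; rewrite set11.
Qed.

End Extant.
End Finished.
End Executions.

(** * Bounds for consensus *)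

Section Consensus.
Variables (n t k : nat) (mode : port_mode) (A : algorithm n bool bool).
Hypothesis tn : t < n.
Hypothesis solA : solves_consensus mode t A.
Hypothesis fin : forall (x : 'I_n -> bool) (F : crash_pattern n),
  num_crashes F <= t -> finished_by (execution mode A x F) k.

(** An isolated node decides its own input [b]: it takes the same course as when all inputs are [b],
    where validity forces [b]. Isolating two nodes with opposite inputs then violates agreement. *)
Lemma consensus_crash_bound : t <= k.*2.
Proof.
rewrite leqNgt; apply/negP => ltkt.
have isolated_decision v b : isolated_status A v b k = Halted b.
  have vU : v \notin isolators A v b k by rewrite !inE eqxx.
  have leU : #|isolators A v b k| <= t by have := card_isolators A v b k; lia.
  have [y hy] := finished_halted fin (fun=> b) leU vU.
  have leF : num_crashes (initial_crashes (isolators A v b k)) <= t.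
    by rewrite num_initial_crashes.
  have [_ _ valid] := solA (fun=> b) leF.
  have [_ yb] := valid v y (ex_intro _ k hy).
  by rewrite -{2}yb -hy isolated_execution.
have [v [w [vw wU vW]]] : exists v w, [/\ v != w,
    w \notin isolators A v false k & v \notin isolators A w true k].
  by apply: (@exists_mutual_nonmembers _ k) => [u|u|]; rewrite ?card_isolators //; lia.
(* At most [k.*2 < t] crashes; they spare [v] and [w], as neither isolates the other. *)
pose D := isolators A v false k :|: isolators A w true k.
pose x u := u == w.
have leF : num_crashes (initial_crashes D) <= t.
  rewrite num_initial_crashes; apply: leq_trans (leq_card_setU _ _) _.
  by have := card_isolators A v false k; have := card_isolators A w true k; lia.
have vD : v \notin D by rewrite in_setU (negPf vW) orbF !inE eqxx.
have wD : w \notin D by rewrite in_setU (negPf wU) !inE eqxx.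
have [_ agree _] := solA x leF.
have xv : x v = false by apply/negbTE.
have xw : x w = true by apply: eqxx.
suff: false = true by [].
apply: (agree v w); exists k; rewrite isolated_execution // ?xv ?xw //;
  by rewrite ?subsetUl ?subsetUr.
Qed.

Lemma consensus_spread_bound : n <= 3 ^ k.
Proof.
have le0 : #|set0 : {set 'I_n}| <= t by rewrite cards0.
have leF : num_crashes (initial_crashes (set0 : {set 'I_n})) <= t.
  by rewrite num_initial_crashes.
pose e x := execution mode A x (initial_crashes set0).
pose x i (u : 'I_n) := u < i.
(* By agreement and termination, [P i] tells the decision of every node on the input [x i], in which
   exactly the first [i] nodes have 1. *)
pose P i := exists v, node (e (x i) k) v = Halted true.
have decision i v : exists2 b, node (e (x i) k) v = Halted b & P i <-> b = true.
  have [b hb] := finished_halted fin (x i) le0 (negbT (in_set0 v)).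
  exists b => //; split=> [[w hw]|bT]; last by exists v; rewrite -bT.
  have [_ agree _] := solA (x i) leF.
  by apply: agree (ex_intro _ k hb) (ex_intro _ k hw).
have nP0 : ~ P 0.
  move=> [v hv]; have [_ _ valid] := solA (x 0) leF.
  by have [w] := valid v true (ex_intro _ k hv).
have Pn : P n.
  have [b hb [_]] := decision n (Ordinal (leq_ltn_trans (leq0n t) tn)); apply.
  have [_ _ valid] := solA (x n) leF.
  by have [w ->] := valid _ b (ex_intro _ k hb); rewrite /x ltn_ord.
have [i ltin [nPi PSi]] := prop_switch nP0 Pn.
apply: (@all_differ_bound _ _ _ mode A (x i) (x i.+1)
  (initial_crashes set0) (initial_crashes set0) (Ordinal ltin)) => //.
  by move=> v vi; rewrite /x ltnS [RHS]leq_eqVlt; move: vi; rewrite -val_eqE /= => /negPf ->.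
move=> v; have [b hb bP] := decision i v; have [b' hb' b'P] := decision i.+1 v.
rewrite -/(e (x i)) -/(e (x i.+1)) hb hb' => -[bb'].
by apply: nPi; apply/bP; rewrite bb'; apply/b'P.
Qed.

End Consensus.

(** * Combination of the two bounds *)

Lemma worst_case_of_bounds (R : realType) (mode : port_mode) (n t : nat)
    (X Y : Type) (A : algorithm n X Y) :
  0 < t -> t < n ->
  (forall x F, num_crashes F <= t -> terminates (execution mode A x F)) ->
  (forall k,
    (forall x F, num_crashes F <= t -> finished_by (execution mode A x F) k) ->
    t <= k.*2 /\ n <= 3 ^ k) ->
  worst_case_at_least mode t A (8^-1 * (t%:R + ln n%:R) : R)%R.
Proof.
move=> t0 tn term bounds; set b : R := (_ * _)%R.
have n0 : 0 < n by apply: leq_ltn_trans tn.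
have ln0 : (0 <= ln n%:R :> R)%R by rewrite ln_ge0 // Num.Theory.ler1n.
have t1 : (1 <= t%:R :> R)%R by rewrite Num.Theory.ler1n.
have b0 : (0 <= b)%R by rewrite /b; lra.
have /andP[leb ltb] := Num.Theory.truncn_itv b0.
apply: (@worst_case_of_unfinished _ _ _ _ _ _ _ (Num.truncn b)) => //.
  exact: Order.POrderTheory.ltW.
(* With [k] the integer part of [b], the bounds give [t <= 2k] and [ln n <= k ln 3 <= 2k]. So
   [t + ln n <= 4k <= 4b], which is half of [t + ln n]: impossible for [t >= 1]. *)
move=> /bounds; move: (Num.truncn b) leb {ltb} => k leb [lt2k le3k].
have tk : (t%:R <= 2 * k%:R :> R)%R.
  by rewrite -GRing.natrM Num.Theory.ler_nat mul2n.
have lnk : (ln n%:R <= 2 * k%:R :> R)%R.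
  have ln3 : (ln 3 <= 2 :> R)%R.
    by have := @le_ln1Dx R 2; rewrite (_ : 1 + 2 = 3)%R; [apply; lra | lra].
  have -> : (2 * k%:R = 2 *+ k :> R)%R by rewrite GRing.mulr_natr.
  apply: (@Order.POrderTheory.le_trans _ _ (ln 3 *+ k)%R).
    rewrite -lnXn // -GRing.natrX ler_ln ?Num.Theory.ler_nat //.
      by rewrite Num.Theory.posrE Num.Theory.ltr0n.
    by rewrite Num.Theory.posrE Num.Theory.ltr0n expn_gt0.
  exact: Num.Theory.ler_wMn2r.
by move: leb; rewrite /b; lra.
Qed.

Theorem theorem13 (R : realType) :
  exists c : R, (0 < c)%R /\
    forall (mode : port_mode) (n t : nat), 0 < t -> t < n ->
      [/\ forall A : algorithm n bool bool,
            solves_consensus mode t A ->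
            worst_case_at_least mode t A (c * (t%:R + ln n%:R))%R,
          forall (Rumor : choiceType)
                 (A : algorithm n Rumor {fset 'I_n * Rumor}),
            inhabited Rumor -> solves_gossiping mode t A ->
            worst_case_at_least mode t A (c * (t%:R + ln n%:R))%R
        & forall A : algorithm n unit {set 'I_n},
            solves_checkpointing mode t A ->
            worst_case_at_least mode t A (c * (t%:R + ln n%:R))%R].
Proof.
exists (8^-1)%R; split; first by lra.
move=> mode n t t0 tn; split=> [A solA|Rumor A [a] solA|A solA];
  apply: worst_case_of_bounds => //.
- by move=> x F /(solA x)[].
- move=> k fin; split; first exact: consensus_crash_bound fin.
  exact: consensus_spread_bound fin.
- by move=> x F /(solA x)[].
(* One fixed assignment of rumors suffices, here a constant one. *)
- move=> k fin; pose x (_ : 'I_n) := a.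
  pose extant (E : {fset 'I_n * Rumor}) w := (w, x w) \in E.
  have sound F : num_crashes F <= t -> let e := execution mode A x F in
      forall v E w, halts_with e v E -> crashes_silently F e w -> ~~ extant E w.
    by move=> /(solA x)[].
  have complete F : num_crashes F <= t -> let e := execution mode A x F in
      forall v E w E', halts_with e v E -> halts_with e w E' -> extant E w.
    by move=> /(solA x)[].
  have := extant_crash_bound fin tn sound complete.
  by have := extant_spread_bound fin tn sound complete t0; lia.
- by move=> x F /(solA x)[].
- move=> k fin; pose x (_ : 'I_n) := tt.
  pose extant (E : {set 'I_n}) w := w \in E.
  have sound F : num_crashes F <= t -> let e := execution mode A x F in
      forall v E w, halts_with e v E -> crashes_silently F e w -> ~~ extant E w.
    by move=> /(solA x)[].
  have complete F : num_crashes F <= t -> let e := execution mode A x F in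
      forall v E w E', halts_with e v E -> halts_with e w E' -> extant E w.
    by move=> /(solA x)[].
  have := extant_crash_bound fin tn sound complete.
  by have := extant_spread_bound fin tn sound complete t0; lia.
Qed.
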